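(* Let $\mathcal{P}\subset\Delta(\mathcal{S})^{\mathcal{S}\times\mathcal{A}}$ be a nonempty convex compact uncertainty set. Then $$\Big(\forall\, V\in\mathbb{R}^{\mathcal{S}\times\mathcal{A}\times\mathcal{S}},\ \bigcap_{(s,a)\in\mathcal{S}\times\mathcal{A}}\arg\min_{P\in\mathcal{P}}\langle P_{sa},V_{sa}\rangle\neq\emptyset\Big)\iff \mathcal{P}=\prod_{(s,a)\in\mathcal{S}\times\mathcal{A}}\mathcal{P}_{sa} ,$$ where $\mathcal{P}_{sa}$ is the marginal of $\mathcal{P}$ at the state-action pair $(s,a)$.
   Context: $\mathcal{S}$ (states) and $\mathcal{A}$ (actions) are finite nonempty sets; $\Delta(E)$ denotes the set of probability distributions on a finite set $E$. Elements of $\mathcal{P}\subset\Delta(\mathcal{S})^{\mathcal{S}\times\mathcal{A}}$ are written $P=(P_{sa})_{(s,a)}$ with $P_{sa}\in\Delta(\mathcal{S})\subset\mathbb{R}^{\mathcal{S}}$. For $V\in\mathbb{R}^{\mathcal{S}\times\mathcal{A}\times\mathcal{S}}$, $V_{sa}=(V_{sas'})_{s'}\in\mathbb{R}^{\mathcal{S}}$; $\langle\cdot,\cdot\rangle$ is the usual scalar product. The marginal of $\mathcal{P}$ at $(s,a)$ is $\mathcal{P}_{sa}=\{p\in\Delta(\mathcal{S}) : \exists\,P\in\mathcal{P},\ P_{sa}=p\}$. (The condition $\mathcal{P}=\prod_{(s,a)}\mathcal{P}_{sa}$ is called sa-rectangularity.) *)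

(* Defs.v *)
(* MathComp / MathComp-Analysis *)
From HB Require Import structures.
From mathcomp Require Import all_boot all_order all_algebra.
From mathcomp Require Import all_classical all_reals all_analysis.
Set Implicit Arguments.
Unset Strict Implicit.
Unset Printing Implicit Defensive.
Import Order.TTheory GRing.Theory Num.Theory.
Import numFieldNormedType.Exports.
Local Open Scope classical_set_scope.
Local Open Scope ring_scope.

(* [R^o] is [R] as a module over itself, which makes [E -> R^o] an lmodType. *)
Definition simplex (R : realType) (E : finType) : set (E -> R^o) :=
  [set p | (forall e, 0 <= p e) /\ \sum_(e : E) p e = 1].

Definition scalar_product (R : realType) (E : finType) (p v : E -> R^o) : R :=
  \sum_(e : E) p e * v e.

Definition argmin (R : realType) (T : Type) (D : set T) (f : T -> R) : set T :=
  [set x | D x /\ forall y, D y -> f x <= f y].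

(* The ambient space R^(S x A x S), split as (R^S)^(S x A). *)
Notation kernel_space R S A := ((S * A)%type -> S -> R^o).

Definition marginal (R : realType) (S A : finType)
    (PP : set (kernel_space R S A)) (sa : S * A) : set (S -> R^o) :=
  [set p | simplex p /\ exists2 P, PP P & P sa = p].

Definition set_product (I T : Type) (X : I -> set T) : set (I -> T) :=
  [set f | forall i, X i (f i)].

(* Main.v *)
Require Import Defs.
From HB Require Import structures.
From mathcomp Require Import all_boot all_order all_algebra.
From mathcomp Require Import all_classical all_reals all_analysis.
From mathcomp Require Import ring lra.
Import Order.TTheory GRing.Theory Num.Theory.
Import numFieldNormedType.Exports.
Local Open Scope classical_set_scope.
Local Open Scope ring_scope.

(** If [PP] is the product of its marginals, compactness yields for each pair
    [sa] a minimizer of [P |-> <P sa, V sa>] over [PP]; splicing together the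
    [sa]-components of these minimizers gives a kernel that is still in [PP]
    and minimizes all the functionals at once.

    Conversely, suppose that some [Q] in the product of the marginals is not in
    [PP].  Since [PP] is convex and compact, a linear functional
    [P |-> \sum_sa <P sa, V sa>] takes at [Q] a value strictly below all its
    values on [PP] ([strict_separation]).  Let [P0] minimize every
    [<P sa, V sa>] over [PP].  Each component of [Q] is a component of some
    element of [PP], so [<P0 sa, V sa> <= <Q sa, V sa>] for every [sa]; summing
    contradicts the separation.

    The separating functional is built from the point [P0] of [PP] nearest to
    [Q] for the Euclidean distance: [V = P0 - Q] works, because moving from
    [P0] towards another point of [PP] cannot decrease the distance to [Q]. *)

Definition pairing {R : realType} {I J : finType} (P V : I -> J -> R^o) : R :=
  \sum_(i : I) scalar_product (P i) (V i).

Lemma pairingDl {R : realType} {I J : finType} (P Q V : I -> J -> R^o) :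
  pairing (P + Q) V = pairing P V + pairing Q V.
Proof.
rewrite /pairing -big_split/=; apply: eq_bigr => i _.
rewrite /scalar_product -big_split/=; apply: eq_bigr => j _.
by rewrite -mulrDl.
Qed.

Lemma pairingZl {R : realType} {I J : finType} (a : R) (P V : I -> J -> R^o) :
  pairing (a *: P) V = a * pairing P V.
Proof.
rewrite /pairing mulr_sumr; apply: eq_bigr => i _.
rewrite /scalar_product mulr_sumr; apply: eq_bigr => j _.
by rewrite mulrA.
Qed.

Lemma pairingC {R : realType} {I J : finType} (P V : I -> J -> R^o) :
  pairing P V = pairing V P.
Proof. by apply: eq_bigr => i _; apply: eq_bigr => j _; rewrite mulrC. Qed.

Lemma pairing_line {R : realType} {I J : finType} (t : R)
    (D X : I -> J -> R^o) :
  pairing (t *: D + X) (t *: D + X) =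
  pairing X X + (2 * (t * pairing D X) + t ^+ 2 * pairing D D).
Proof.
rewrite pairingDl pairingZl !(pairingC _ (t *: D + X)) !pairingDl !pairingZl.
by rewrite (pairingC X D); ring.
Qed.

Lemma pairing_ge0 {R : realType} {I J : finType} (P : I -> J -> R^o) :
  0 <= pairing P P.
Proof.
by apply: sumr_ge0 => i _; apply: sumr_ge0 => j _; rewrite -expr2 sqr_ge0.
Qed.

Lemma pairing_eq0 {R : realType} {I J : finType} (P : I -> J -> R^o) :
  pairing P P = 0 -> P = 0.
Proof.
have sq_ge0 i : 0 <= scalar_product (P i) (P i).
  by apply: sumr_ge0 => j _; rewrite -expr2 sqr_ge0.
move/psumr_eq0P => /(_ (fun i _ => sq_ge0 i)) P0.
apply/funext => i; apply/funext => j.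
have /psumr_eq0P := P0 i isT.
move=> /(_ (fun j _ => sqr_ge0 (P i j))) /(_ j isT) /eqP.
by rewrite mulf_eq0 orbb => /eqP.
Qed.

Lemma coord_continuous {R : realType} {I J : finType} (i : I) (j : J) :
  continuous (fun P : {ptws I -> {ptws J -> R^o}} => P i j : R^o).
Proof.
move=> P; apply: (@continuous_comp _ _ _
  (fun P : {ptws I -> {ptws J -> R^o}} => P i)
  (fun p : {ptws J -> R^o} => p j)).
- exact: (@proj_continuous I (fun=> {ptws J -> R^o}) i).
- exact: (@proj_continuous J (fun=> R^o) j).
Qed.

Lemma argmin_nonempty {R : realType} {T : topologicalType} (C : set T)
    (f : T -> R) :
  C !=set0 -> compact C -> continuous (f : T -> R^o) -> argmin C f !=set0.
Proof.
move=> C0 cC cf.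
have [//|c /set_mem Cc minf] := @compact_EVT_min T R f C C0 cC.
  exact: continuous_subspaceT.
by exists c; split=> // y Cy; apply: minf; exact: mem_set.
Qed.

(** At [t = - b / (c - b)] the quadratic has the sign of [b] as soon as
    [b < 0], and this [t] lies in the unit interval because [0 <= c]. *)
Lemma quadratic_slope_ge0 {R : realType} (b c : R) : 0 <= c ->
  (forall t, 0 <= t <= 1 -> 0 <= 2 * (t * b) + t ^+ 2 * c) -> 0 <= b.
Proof.
move=> c0 ge0; rewrite leNgt; apply/negP => b0.
have cb0 : 0 < c - b by lra.
pose t := - b / (c - b).
have t0 : 0 < t by rewrite divr_gt0// oppr_gt0.
have tcb : t * (c - b) = - b by rewrite /t divfK// gt_eqF.
have t1 : t <= 1 by rewrite ler_pdivrMr// mul1r; lra.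
have /ge0 : 0 <= t <= 1 by rewrite (ltW t0) t1.
have -> : 2 * (t * b) + t ^+ 2 * c = t * (b + t * b).
  by rewrite (_ : b + t * b = 2 * b + t * c); [ring|lra].
by rewrite pmulr_rge0//; nra.
Qed.

(** The functional is the pairing with the vector [V] from [Q] to its nearest
    point [P0] in [C].  By convexity the segment from [P0] to [P] stays in [C],
    so the squared distance to [Q], a quadratic function along it, has a
    nonnegative derivative at [P0]: this is [0 <= pairing (P - P0) V].
    Strictness is the positivity of [pairing V V]. *)
Lemma strict_separation {R : realType} {I J : finType}
    (C : set (I -> J -> R^o)) (Q : I -> J -> R^o) :
  C !=set0 -> @convex_set R (I -> J -> R^o) C ->
  @compact {ptws I -> {ptws J -> R^o}} C -> ~ C Q ->
  exists V, forall P, C P -> pairing Q V < pairing P V.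
Proof.
move=> C0 convC cptC CQ.
have [P0 [CP0 nearest]] : argmin C (fun P => pairing (P - Q) (P - Q)) !=set0.
  apply: (@argmin_nonempty R {ptws I -> {ptws J -> R^o}}) => //.
  apply: continuous_big => [|i _]; first exact: add_continuous.
  apply: continuous_big => [|j _]; first exact: add_continuous.
  have cD : continuous (fun P : {ptws I -> {ptws J -> R^o}} =>
      P i j - Q i j : R^o).
    by move=> P; apply: continuousB;
      [exact: (coord_continuous i j P)|exact: cst_continuous].
  by move=> P; exact: (continuousM (cD P) (cD P)).
exists (P0 - Q) => P CP.
have V_gt0 : 0 < pairing (P0 - Q) (P0 - Q).
  rewrite lt_neqAle pairing_ge0 andbT eq_sym; apply/eqP.
  by move/pairing_eq0/subr0_eq => P0Q; apply: CQ; rewrite -P0Q.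
suff slope : 0 <= pairing (P - P0) (P0 - Q).
  have -> : P = (P - P0) + ((P0 - Q) + Q) by rewrite (subrK Q) subrK.
  by rewrite (pairingDl (P - P0)) (pairingDl (P0 - Q)); lra.
apply: (quadratic_slope_ge0 _ _ (pairing_ge0 (P - P0))) => t /andP[t0 t1].
have Ct : C (t *: P + (1 - t) *: P0).
  exact/set_mem/(convC P P0 (Itv01 t0 t1) (mem_set CP) (mem_set CP0)).
have := nearest _ Ct.
have -> : t *: P + (1 - t) *: P0 - Q = t *: (P - P0) + (P0 - Q).
  by apply/funext => i; apply/funext => j; rewrite !fctE/= /GRing.scale/=; ring.
by rewrite pairing_line; lra.
Qed.

Theorem theorem4 (R : realType) (S A : finType)
    (S_nonempty : (0 < #|S|)%N) (A_nonempty : (0 < #|A|)%N)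
    (PP : set (kernel_space R S A))
    (PP_kernels : PP `<=` set_product (fun _ : S * A => @simplex R S))
    (PP_nonempty : PP !=set0)
    (PP_convex : @convex_set R (kernel_space R S A) PP)
    (PP_compact : @compact {ptws (S * A)%type -> {ptws S -> R^o}} PP) :
  (forall V : kernel_space R S A,
     \bigcap_(sa in [set: S * A])
        argmin PP (fun P => scalar_product (P sa) (V sa)) !=set0)
  <-> PP = set_product (fun sa : S * A => marginal PP sa).
Proof.
split=> [common_argmin|rect V].
  apply/seteqP; split=> [P PPP sa|Q margQ].
    by split; [exact: PP_kernels|exists P].
  apply: contrapT => PPQ.
  have [V sepV] :=
    @strict_separation R (S * A)%type S _ _ PP_nonempty PP_convex PP_compact PPQ.
  have [P0 minP0] := common_argmin V.
  have PPP0 : PP P0.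
    (* membership is part of each argmin, so one index is required *)
    have [s _] := card_gt0P S_nonempty; have [a _] := card_gt0P A_nonempty.
    by have [] := minP0 (s, a) I.
  have := sepV _ PPP0; rewrite ltNge => /negP; apply.
  apply: ler_sum => sa _.
  have [_ [P PPP <-]] := margQ sa; have [_] := minP0 sa I; exact.
have min_at sa : argmin PP (fun P => scalar_product (P sa) (V sa)) !=set0.
  apply: (@argmin_nonempty R {ptws (S * A)%type -> {ptws S -> R^o}}) => //.
  apply: continuous_big => [|s _]; first exact: add_continuous.
  by move=> P; apply: continuousM;
    [exact: (coord_continuous sa s P)|exact: cst_continuous].
have [F minF] := choice min_at.
(* the diagonal splices the [sa]-components of the separate minimizers *)
exists (fun sa => F sa sa) => sa _; split; last by case: (minF sa).
rewrite rect => sa'; have [PPF _] := minF sa'.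
by split; [exact: PP_kernels|exists (F sa')].
Qed.
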